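(* Let $k$ be a positive integer. There exist polynomials $A(n,d), B(n,d)$ in $n$ of degree at most $2k$, whose coefficients are rational functions of $d$, such that $$\sum_{\lambda\in \mathcal{C}_{n,dn+1}}|\lambda|^k = A(n,d)\, M_d(n) + B(n,d)\, M_d(n+1).$$ Likewise, there exist polynomials $A'(n,d), B'(n,d)$ in $n$ of degree at most $2k$, with coefficients rational functions of $d$, such that $$\sum_{\lambda\in \mathcal{C}_{n,dn-1}}|\lambda|^k = A'(n,d)\, M_d(n) + B'(n,d)\, M_d(n+1).$$
   Context: A partition $\lambda=(\lambda_1\ge\dots\ge\lambda_\ell)$ has size $|\lambda|=\sum_i\lambda_i$. The hook length of a box $(i,j)$ of its Young diagram is the number of boxes directly to its right, directly below it, plus the box itself. For a positive integer $t$, $\lambda$ is a $t$-core if none of its hook lengths is divisible by $t$; it is an $(s,t)$-core if it is both an $s$-core and a $t$-core. For positive integers $n,d$, $\mathcal{C}_{n,dn+1}$ (resp. $\mathcal{C}_{n,dn-1}$) denotes the (finite) set of $(n,dn+1)$-core (resp. $(n,dn-1)$-core) partitions with distinct parts. The sequence $M_d(n)$ is defined by $M_d(-1)=0$, $M_d(0)=1$, $M_d(n)=M_d(n-1)+dM_d(n-2)$ for $n\ge1$. *)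

(* Defs.v *)
From HB Require Import structures.
From mathcomp Require Import all_boot all_order all_algebra.
From mathcomp Require Import boolp classical_sets functions cardinality fsbigop.

Set Implicit Arguments.
Unset Strict Implicit.
Unset Printing Implicit Defensive.

Import Order.TTheory GRing.Theory Num.Theory.

Local Open Scope ring_scope.

(* Partitions are weakly decreasing sequences of positive parts; the size of
   the partition is [sumn la]. *)
Definition is_partition (la : seq nat) : bool :=
  sorted geq la && (0%N \notin la).

(* Rows, columns and boxes are numbered from 0. *)
Definition is_box (la : seq nat) (i j : nat) : bool :=
  (i < size la)%N && (j < nth 0%N la i)%N.

Definition arm (la : seq nat) (i j : nat) : nat := (nth 0 la i - j.+1)%N.

Definition leg (la : seq nat) (i j : nat) : nat :=
  count (fun x => (j < x)%N) (drop i.+1 la).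

Definition hook (la : seq nat) (i j : nat) : nat :=
  (arm la i j + leg la i j).+1.

(* As hook lengths are positive, every partition is a 0-core. *)
Definition is_core (t : nat) (la : seq nat) : Prop :=
  forall i j, is_box la i j -> ~~ (t %| hook la i j)%N.

Definition dcores (s t : nat) : set (seq nat) :=
  [set la | [/\ is_partition la, uniq la, is_core s la & is_core t la]].

(* [Mshift d m] is M_d(m - 1), so that the recursion starts at M_d(-1). *)
Fixpoint Mshift (d m : nat) : nat :=
  match m with
  | 0 => 0
  | 1 => 1
  | (m''.+1 as m').+1 => (Mshift d m' + d * Mshift d m'')%N
  end.

Definition M (d n : nat) : nat := Mshift d n.+1.

(* Rational functions of one variable over the rationals, and their values at
   a point. They are evaluated in lowest terms, so that neither the value nor
   the set of poles depends on the representing ratio. *)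
Notation ratfun := {fraction {poly rat}}.

Definition rf_num (r : ratfun) : {poly rat} :=
  let f := frac (repr r) in f.1 %/ gcdp f.1 f.2.

Definition rf_den (r : ratfun) : {poly rat} :=
  let f := frac (repr r) in f.2 %/ gcdp f.1 f.2.

Definition rf_regular (r : ratfun) (x : rat) : bool := (rf_den r).[x] != 0.

Definition rf_eval (r : ratfun) (x : rat) : rat :=
  (rf_num r).[x] / (rf_den r).[x].

(* Polynomials in n with coefficients in Q(d). *)
Definition regular_at (A : {poly ratfun}) (d : rat) : Prop :=
  forall i, rf_regular A`_i d.

Definition eval_at (A : {poly ratfun}) (n d : rat) : rat :=
  (map_poly (fun r => rf_eval r d) A).[n].

Section RatfunFacts.
Local Notation "x %:F" := (@FracField.tofrac _ x).
Local Open Scope quotient_scope.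

Lemma rf_cross (p q : {poly rat}) : q != 0 ->
  rf_num (p%:F / q%:F) * q = rf_den (p%:F / q%:F) * p
  /\ coprimep (rf_num (p%:F / q%:F)) (rf_den (p%:F / q%:F)).
Proof.
move=> q0; rewrite /rf_num /rf_den; set r := p%:F / q%:F.
set f := repr r; have d0 : \d_f != 0 by apply: denom_ratioP.
have Er : r = \pi_({fraction {poly rat}}) (Ratio p q).
  rewrite /r; unlock FracField.tofrac.
  rewrite -[X in _ * X]FracField.pi_inv -[LHS]FracField.pi_mul.
  rewrite /FracField.invf /FracField.mulf !numden_Ratio ?oner_eq0 //.
  by rewrite mulr1 mul1r.
have cross : \n_f * q = \d_f * p.
  have := FracField.equivf_l (Ratio p q); rewrite -Er -/f.
  by rewrite !numden_Ratio.
set g := gcdp _ _.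
have g0 : g != 0 by rewrite gcdp_eq0 negb_and d0 orbT.
split.
  apply: (mulIf g0); rewrite mulrAC divpK ?dvdp_gcdl //.
  by rewrite cross mulrAC divpK ?dvdp_gcdr.
by rewrite coprimep_div_gcd // d0 orbT.
Qed.

Lemma rf_evalE (p q : {poly rat}) (x : rat) : q.[x] != 0 ->
  rf_regular (p%:F / q%:F) x /\ rf_eval (p%:F / q%:F) x = p.[x] / q.[x].
Proof.
move=> qx; have q0 : q != 0 by apply: contraNneq qx => ->; rewrite horner0.
have [cross cop] := rf_cross p q0.
rewrite /rf_regular /rf_eval; set N := rf_num _ in cross cop *.
set D := rf_den _ in cross cop *.
have Dq : D %| q.
  by rewrite -(Gauss_dvdpr q (q := N)) 1?coprimep_sym // cross dvdp_mulr.
have Dx : D.[x] != 0.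
  apply: contraNneq qx => Dx; case/dvdpP: Dq => c ->.
  by rewrite hornerM Dx mulr0.
split=> //; apply: (mulIf qx); apply: (mulIf Dx).
rewrite mulrAC !divfK // -hornerM cross hornerM mulrC; exact: erefl.
Qed.

End RatfunFacts.

Section Finiteness.
Local Open Scope nat_scope.

(* First-column hook lengths. *)
Fixpoint beta (la : seq nat) : seq nat :=
  if la is a :: l then (a + size l) :: beta l else [::].

Lemma sorted_head a l : sorted geq (a :: l) -> all (fun y => y <= a) l.
Proof.
by move=> sl; apply: (order_path_min _ sl) => u v w /= h1 h2; apply: leq_trans h2 h1.
Qed.

Lemma beta_gap l x : sorted geq l ->
  x \in beta l \/ exists j, j + count (fun y => y <= j) l = x.
Proof.
elim: l x => [|b l IH] x sl; first by right; exists x; rewrite /= addn0.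
have sl' := path_sorted sl.
have lb := sorted_head sl.
have allj j : b <= j -> count (fun y => y <= j) l = size l.
  move=> bj; apply/eqP; rewrite -all_count.
  by apply: sub_all lb => y yb; apply: leq_trans yb bj.
rewrite /= inE; case: (ltngtP x (b + size l)) => [lt|gt|->] /=; last by left.
- have [|[j hj]] := IH x sl'; first by left.
  right; exists j; case: (leqP b j) => [bj|_]; last by rewrite add0n.
  by move: lt; rewrite -hj (allj j bj) ltn_add2r ltnNge bj.
- right; exists (x - (size l).+1).
  have bj : b <= x - (size l).+1 by rewrite leq_subRL ?addSn 1?addnC //;
    apply: leq_trans gt; rewrite ltnS leq_addl.
  rewrite bj (allj _ bj) add1n subnK //.
  by apply: leq_trans gt; rewrite ltnS leq_addl.
Qed.

Lemma beta_hook a l t : sorted geq (a :: l) -> is_core t (a :: l) ->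
  0 < t -> t <= a + size l -> a + size l - t \in beta l.
Proof.
move=> sl co t0 ta; have [//|[j hj]] := beta_gap (a + size l - t) (path_sorted sl).
have lb := sorted_head sl.
have ja : j < a.
  rewrite ltnNge; apply/negP => aj.
  have cj : count (fun y => y <= j) l = size l.
    by apply/eqP; rewrite -all_count; apply: sub_all lb => y /leq_trans; apply.
  have : a + size l <= a + size l - t by rewrite -hj cj leq_add2r.
  by rewrite leqNgt ltn_subrL t0 (leq_trans t0 ta).
have := co 0 j; rewrite /is_box /= ja => /(_ isT).
suff -> : hook (a :: l) 0 j = t by rewrite dvdnn.
rewrite /hook /arm /leg /= drop0.
have cc := count_predC (fun y => y <= j) l.
have -> : count (fun x => j < x) l = size l - count (fun y => y <= j) l.
  rewrite -cc addnC addnK; apply: eq_count => y /=; by rewrite ltnNge.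
have cl : count (fun y => y <= j) l <= size l by apply: count_size.
rewrite addnBA // -subSn; last exact: leq_trans cl (leq_addl _ _).
rewrite -addSn subnSK // addnBAC 1?ltnW // -subnDA hj.
by rewrite subKn.
Qed.

Lemma core_cons t a l : is_core t (a :: l) -> is_core t l.
Proof. by move=> co i j; apply: (co i.+1 j). Qed.

Lemma partition_cons a l : is_partition (a :: l) -> is_partition l.
Proof.
case/andP=> sl; rewrite inE negb_or => /andP[_ l0].
by rewrite /is_partition (path_sorted sl).
Qed.

Lemma beta_notin s t la u v : is_partition la -> is_core s la ->
  is_core t la -> u * s + v * t \notin beta la.
Proof.
have [n] := ubnP (u + v); elim: n u v la => // n IHn u v la.
rewrite ltnS => luv; elim: la => // a l IHl pa cs ct.
have pl := partition_cons pa; have cls := core_cons cs; have clt := core_cons ct.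
rewrite inE negb_or IHl // andbT; apply/negP => /eqP E.
have sl : sorted geq (a :: l) by case/andP: pa.
have a0 : 0 < a by case/andP: pa => _; rewrite inE negb_or eq_sym lt0n => /andP[].
have step w x : 0 < w -> x + w = a + size l -> is_core w (a :: l) -> x \in beta l.
  move=> w0 Ex cw; have -> : x = a + size l - w by rewrite -Ex addnK.
  by apply: beta_hook => //; rewrite -Ex leq_addl.
have [/andP[s0 u0]|su0] := boolP ((0 < s) && (0 < u)).
  have h : u.-1 + v < n by rewrite -ltnS -addSn prednK // ltnS.
  have /negP := IHn _ _ _ h pl cls clt; apply; apply: (step s) => //.
  by rewrite addnAC -mulSnr prednK.
have [/andP[t0 v0]|tv0] := boolP ((0 < t) && (0 < v)).
  have h : u + v.-1 < n by rewrite -ltnS -addnS prednK // ltnS.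
  have /negP := IHn _ _ _ h pl cls clt; apply; apply: (step t) => //.
  by rewrite -addnA -mulSnr prednK.
have us : u * s = 0 by apply/eqP; rewrite muln_eq0 -[_ || _]negbK negb_or -!lt0n andbC.
have vt : v * t = 0 by apply/eqP; rewrite muln_eq0 -[_ || _]negbK negb_or -!lt0n andbC.
by move: a0 E; rewrite us vt; case: (a).
Qed.

Lemma representable s t h : 0 < s -> coprime s t -> s * t <= h ->
  exists u v, u * s + v * t = h.
Proof.
move=> s0 cop sth; case: (posnP t) cop sth => [->|t0] cop sth.
  by exists h, 0; move: cop; rewrite /coprime gcdn0 => /eqP ->; rewrite muln1 mul0n addn0.
have st0 : 0 < s * t by rewrite muln_gt0 s0.
pose x := chinese s t 0 h %% (s * t).
have xh : x <= h by apply: leq_trans sth; rewrite ltnW // ltn_mod.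
have /dvdnP[u xs] : s %| x.
  rewrite /dvdn /x modn_dvdm ?dvdn_mulr //.
  by rewrite chinese_modl // mod0n.
have /dvdnP[v xt] : t %| h - x.
  rewrite -eqn_mod_dvd // /x modn_dvdm ?dvdn_mull //.
  by rewrite chinese_modr.
by exists u, v; rewrite -xs -xt subnKC.
Qed.

Lemma dcores_finite s t : 0 < s -> coprime s t -> finite_set (dcores s t).
Proof.
move=> s0 cop; pose N := s * t.
apply: (@sub_finite_set _ _
  ((fun b : N.-bseq 'I_N.+1 => map val b) @` setT)); last first.
  by apply: finite_image; exact: finite_finset.
move=> la [pa _ cs ct].
have hd : forall a l, la = a :: l -> a + size l < N.
  move=> a l ela; rewrite ltnNge; apply/negP => /(representable s0 cop)[u [v E]].
  by have := beta_notin u v pa cs ct; rewrite E ela /= inE eqxx.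
have szla : size la <= N.
  case: (la) (hd) pa => // a l /(_ _ _ erefl) h /andP[_].
  by move=> _ /=; apply: leq_ltn_trans h; apply: leq_addl.
have lela x : x \in la -> x < N.+1.
  case: (la) (hd) pa => // a l /(_ _ _ erefl) h /andP[sl _] xl.
  have xa : x <= a.
    move: xl; rewrite inE => /predU1P[->//|].
    by move/allP: (sorted_head sl) => /[apply].
  rewrite ltnS (leq_trans xa) // ltnW //; apply: leq_ltn_trans h.
  exact: leq_addr.
have sz : size (map (fun x => inord x : 'I_N.+1) la) <= N by rewrite size_map.
exists (Bseq sz) => //=; rewrite -map_comp; apply: map_id_in => x xl /=.
by rewrite inordK // lela.
Qed.

Lemma dcores_plus_finite n d : 0 < n -> finite_set (dcores n (d * n + 1)).
Proof.
move=> n0; apply: dcores_finite => //.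
by rewrite addn1; apply: coprime_dvdl (dvdn_mull d (dvdnn n)) _; apply: coprimenS.
Qed.

Lemma dcores_minus_finite n d : 0 < n -> 0 < d ->
  finite_set (dcores n (d * n - 1)).
Proof.
move=> n0 d0; apply: dcores_finite => //.
have dn0 : 0 < d * n by rewrite muln_gt0 d0.
have : coprime (d * n) (d * n - 1) by rewrite subn1 coprimenP.
exact: coprime_dvdl (dvdn_mull _ (dvdnn n)).
Qed.
End Finiteness.

(* Main.v *)
(* First-column hook lengths turn a partition into a bead set, in which t-cores
   are the sets closed under subtracting t and distinct parts mean that no two
   beads are consecutive. For t = n the beads fill the n runners modulo n from
   the bottom; with c_r beads on runner r, the remaining conditions become
   c_0 = 0, c_r <= d, c_r c_(r+1) = 0 and, in the minus case, c_(n-1) < d, and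
     |la| = P + n Q - (S^2 - S) / 2,
   where P = sum r c_r, Q = sum binom(c_r, 2), S = sum c_r.
   Removing the last runner shows that f = sum P^a Q^b S^e, viewed as a function
   of n, satisfies f(n+2) = f(n+1) + d f(n) + h(n), where h combines sums of
   smaller weight 2a + b + e. Sequences A(n) M_d(n) + B(n) M_d(n+1) solve such
   recurrences, at the cost of raising the degree by one, because 4 d + 1, the
   discriminant of x^2 - x - d, does not vanish. *)

Require Import Defs.
From mathcomp Require Import all_boot all_order all_algebra.
From mathcomp Require Import boolp classical_sets fsbigop.
From mathcomp Require Import zify ring.

Set Implicit Arguments.
Unset Strict Implicit.
Unset Printing Implicit Defensive.

Import Order.TTheory GRing.Theory Num.Theory.

Local Open Scope ring_scope.

(** * Rational functions of d, given by their values *)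

(** Only values at positive integers are constrained, so one may divide by d and by 4 d + 1. Working
    with values postpones the field of fractions to [polyfun_eval]. *)
Definition rational_in_d (r : nat -> rat) : Prop :=
  exists p q : {poly rat}, forall d, (0 < d)%N ->
    q.[d%:R] != 0 /\ r d = p.[d%:R] / q.[d%:R].

Lemma rational_poly (p : {poly rat}) : rational_in_d (fun d => p.[d%:R]).
Proof. by exists p, 1 => d _; rewrite hornerC oner_eq0 divr1. Qed.

Lemma rational_const (c : rat) : rational_in_d (fun=> c).
Proof.
by have [p [q H]] := rational_poly c%:P; exists p, q => d /H; rewrite hornerC.
Qed.

Lemma rational_id : rational_in_d (fun d => d%:R).
Proof.
by have [p [q H]] := rational_poly 'X; exists p, q => d /H; rewrite hornerX.
Qed.

Lemma rational_add r s : rational_in_d r -> rational_in_d s ->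
  rational_in_d (fun d => r d + s d).
Proof.
move=> [p [q H]] [p' [q' H']]; exists (p * q' + p' * q), (q * q') => d d0.
have [q0 ->] := H d d0; have [q0' ->] := H' d d0.
by rewrite ?hornerD !hornerM mulf_neq0 //; split=> //; field; rewrite q0 q0'.
Qed.

Lemma rational_mul r s : rational_in_d r -> rational_in_d s ->
  rational_in_d (fun d => r d * s d).
Proof.
move=> [p [q H]] [p' [q' H']]; exists (p * p'), (q * q') => d d0.
have [q0 ->] := H d d0; have [q0' ->] := H' d d0.
by rewrite ?hornerD !hornerM mulf_neq0 //; split=> //; field; rewrite q0 q0'.
Qed.

Lemma rational_opp r : rational_in_d r -> rational_in_d (fun d => - r d).
Proof.
move=> [p [q H]]; exists (- p), q => d /H[q0 ->].
by rewrite hornerN mulNr.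
Qed.

Lemma rational_inv_id : rational_in_d (fun d => d%:R^-1).
Proof.
exists 1, 'X => d d0; rewrite hornerX hornerC mul1r pnatr_eq0 -lt0n d0.
by split.
Qed.

Lemma rational_inv_disc : rational_in_d (fun d => (4 * d%:R + 1)^-1).
Proof.
exists 1, (4%:P * 'X + 1) => d d0; rewrite !hornerE; split; rewrite ?div1r //.
by rewrite lt0r_neq0 // ltr_wpDl // mulr_ge0.
Qed.

Definition binpoly (i : nat) : {poly rat} :=
  (i`!%:R^-1) *: \prod_(j < i) ('X - (j%:R)%:P).

Lemma size_binpoly i : (size (binpoly i) <= i.+1)%N.
Proof.
apply: (leq_trans (size_scale_leq _ _)); rewrite size_prod_XsubC.
by rewrite /index_enum -enumT size_enum_ord.
Qed.

Lemma binpolyE i n : (binpoly i).[n%:R] = 'C(n, i)%:R.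
Proof.
rewrite /binpoly hornerZ horner_prod.
have f0 : (i`!%:R : rat) != 0 by rewrite pnatr_eq0 -lt0n fact_gt0.
apply: (mulfI f0); rewrite mulVKf // -natrM mulnC bin_ffact.
elim: i {f0} => [|i IH]; first by rewrite big_ord0.
rewrite big_ord_recr /= {}IH ffactnSr natrM hornerXsubC.
(* For n < i the difference n - i truncates to 0, but the falling factorial is already 0. *)
case: (leqP i n) => [le|lt]; first by rewrite natrB.
by rewrite ffact_small // !mul0r.
Qed.

(** * Polynomial combinations of consecutive M_d, and linear recurrences *)

Local Notation u := Mshift.

Lemma MshiftE d n : (u d n.+2)%:R = (u d n.+1)%:R + d%:R * (u d n)%:R :> rat.
Proof. by rewrite -natrM -natrD. Qed.

(* g(n, d) = sum_(i < D) binom(n, i) (a_i(d) M_d(n-1) + b_i(d) M_d(n)). *)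
Fixpoint quasi (D : nat) (g : nat -> nat -> rat) : Prop :=
  if D is i.+1 then
    exists a b g', [/\ rational_in_d a, rational_in_d b, quasi i g' &
      forall n d, (0 < d)%N -> g n d = g' n d +
        'C(n, i)%:R * (a d * (u d n)%:R + b d * (u d n.+1)%:R)]
  else forall n d, (0 < d)%N -> g n d = 0.

Lemma eq_quasi D g h : (forall n d, (0 < d)%N -> g n d = h n d) ->
  quasi D g -> quasi D h.
Proof.
case: D => [|D] E /=; first by move=> H n d d0; rewrite -E // H.
move=> [a [b [g' [ra rb qg H]]]]; exists a, b, g'; split=> // n d d0.
by rewrite -E // H.
Qed.

Lemma quasi0 D : quasi D (fun _ _ => 0).
Proof.
elim: D => [|D IH] //=; exists (fun=> 0), (fun=> 0), (fun _ _ => 0).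
split=> //; do ?exact: rational_const.
by move=> n d _; rewrite !mul0r !addr0 mulr0.
Qed.

Lemma quasi_add D g h : quasi D g -> quasi D h ->
  quasi D (fun n d => g n d + h n d).
Proof.
elim: D g h => [|D IH] g h /=.
  by move=> Hg Hh n d d0; rewrite Hg // Hh // addr0.
move=> [a [b [g' [ra rb qg Hg]]]] [a' [b' [h' [ra' rb' qh Hh]]]].
exists (fun d => a d + a' d), (fun d => b d + b' d).
exists (fun n d => g' n d + h' n d); split; do ?exact: rational_add.
  exact: IH.
by move=> n d d0; rewrite Hg // Hh //; ring.
Qed.

Lemma quasi_scale D r g : rational_in_d r -> quasi D g ->
  quasi D (fun n d => r d * g n d).
Proof.
move=> rr; elim: D g => [|D IH] g /=.
  by move=> Hg n d d0; rewrite Hg // mulr0.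
move=> [a [b [g' [ra rb qg Hg]]]].
exists (fun d => r d * a d), (fun d => r d * b d).
exists (fun n d => r d * g' n d); split; do ?exact: rational_mul.
  exact: IH.
by move=> n d d0; rewrite Hg //; ring.
Qed.

Lemma quasi_sub D g h : quasi D g -> quasi D h ->
  quasi D (fun n d => g n d - h n d).
Proof.
move=> qg qh; apply: quasi_add => //.
apply: eq_quasi (quasi_scale (rational_const (-1)) qh) => n d _.
exact: mulN1r.
Qed.

Lemma quasiS D g : quasi D g -> quasi D.+1 g.
Proof.
move=> qg; exists (fun=> 0), (fun=> 0), g.
split=> //; do ?exact: rational_const.
by move=> n d _; rewrite !mul0r !addr0 mulr0 addr0.
Qed.

Lemma quasi_leq D E g : (D <= E)%N -> quasi D g -> quasi E g.
Proof.
move=> /subnK <-; elim: (E - D)%N => // k IH /IH; rewrite addSn; exact: quasiS.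
Qed.

Lemma quasi_term D i a b : (i < D)%N -> rational_in_d a -> rational_in_d b ->
  quasi D (fun n d =>
    'C(n, i)%:R * (a d * (u d n)%:R + b d * (u d n.+1)%:R)).
Proof.
move=> iD ra rb; apply: (quasi_leq iD); exists a, b, (fun _ _ => 0).
by split=> //; [exact: quasi0 | move=> n d _; rewrite add0r].
Qed.

(** The binomial basis absorbs the factor n through n C(n,D) = (D+1) C(n,D+1) + D C(n,D). *)
Lemma quasi_muln D g : quasi D g -> quasi D.+1 (fun n d => n%:R * g n d).
Proof.
elim: D g => [|D IH] g.
  by move=> H; apply: eq_quasi (quasi0 _) => n d d0; rewrite H // mulr0.
move=> [a [b [g' [ra rb qg Hg]]]].
apply: (@eq_quasi _ (fun n d => n%:R * g' n d
  + (D.+1%:R * ('C(n, D.+1)%:R * (a d * (u d n)%:R + b d * (u d n.+1)%:R))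
  + D%:R * ('C(n, D)%:R * (a d * (u d n)%:R + b d * (u d n.+1)%:R))))).
  move=> n d d0; rewrite Hg // [RHS]mulrDr; congr (_ + _).
  rewrite !mulrA -mulrDl; congr (_ * _).
  have := mul_bin_left n D; rewrite -!natrM => ->.
  case: (leqP D n) => [le|lt]; last by rewrite bin_small // !muln0 addr0.
  by rewrite -natrD -mulnDl subnK.
apply: quasi_add; first exact/quasiS/IH.
by apply: quasi_add; apply: quasi_scale (rational_const _) _; apply: quasi_term.
Qed.

Lemma quasi_muln_exp D y g : quasi D g ->
  quasi (y + D) (fun n d => n%:R ^+ y * g n d).
Proof.
move=> qg; elim: y => [|y IH]; first by apply: eq_quasi qg => n d _; rewrite mul1r.
by apply: eq_quasi (quasi_muln IH) => n d _; rewrite exprS mulrA.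
Qed.

Ltac rational :=
  repeat first [assumption | exact: rational_id | exact: rational_inv_id
   | exact: rational_inv_disc | exact: rational_const
   | apply: rational_add | apply: rational_opp | apply: rational_mul].

(** Pascal's rule creates only lower binomials, and the recurrence rewrites u(n+2) in u(n) and
    u(n+1), so the bound D is kept. *)
Lemma quasi_shift D g : quasi D g -> quasi D (fun n d => g n.+1 d).
Proof.
elim: D g => [|D IH] g; first by move=> H n d d0; apply: H.
move=> [a [b [g' [ra rb qg Hg]]]].
pose t i n d : rat := 'C(n, i)%:R *
  ((b d * d%:R) * (u d n)%:R + (a d + b d) * (u d n.+1)%:R).
have qt i : (i < D.+1)%N -> quasi D.+1 (t i).
  by move=> iD; apply: quasi_term; rational.
case: D => [|D] in IH qg Hg qt *.
  apply: (@eq_quasi _ (t 0)); last exact: qt.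
  move=> n d d0; rewrite Hg // [g' _ _]qg // !bin0 MshiftE /t bin0; ring.
apply: (@eq_quasi _ (fun n d => g' n.+1 d + (t D.+1 n d + t D n d))).
  by move=> n d d0; rewrite Hg // MshiftE /t binS natrD; ring.
by do ?apply: quasi_add; [exact/quasiS/IH | apply: qt | apply: qt].
Qed.

(* With x the shift operator, x^2 = x + d on solutions w of the homogeneous
   recurrence, and the recurrence maps C(n,i) w to C(n,i-1) (x + 2d) w plus
   terms of lower degree; x + 2d has norm d (4 d + 1), so it is invertible. *)
Lemma quasi_recurrence_solvable D h : quasi D h ->
  exists2 f, quasi D.+1 f & forall n d, (0 < d)%N ->
    f n.+2 d = f n.+1 d + d%:R * f n d + h n d.
Proof.
elim: D h => [|D IH] h.
  move=> H; exists (fun _ _ => 0); first exact: quasi0.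
  by move=> n d d0; rewrite H // mulr0 !addr0.
move=> [a [b [h' [ra rb qh Hh]]]].
(* Cramer's rule for the 2 by 2 system w(n+1) + 2d w(n) = a u(n) + b u(n+1), whose determinant is d
   (4d + 1). *)
pose al d := ((1 + 2 * d%:R) * a d - b d * d%:R) * (d%:R^-1 * (4 * d%:R + 1)^-1).
pose be d := (2 * d%:R * b d - a d) * (d%:R^-1 * (4 * d%:R + 1)^-1).
have ral : rational_in_d al by rewrite /al; rational.
have rbe : rational_in_d be by rewrite /be; rational.
pose w d n := al d * (u d n)%:R + be d * (u d n.+1)%:R.
have Tw d n : (0 < d)%N ->
    a d * (u d n)%:R + b d * (u d n.+1)%:R = w d n.+1 + 2 * d%:R * w d n.
  move=> d0; rewrite /w MshiftE /al /be; field.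
  have d0' : (0 : rat) < d%:R by rewrite ltr0n.
  by rewrite !lt0r_neq0 // ltr_wpDl // mulr_ge0 // ltW.
pose f1 n d := 'C(n, D.+1)%:R * w d n.
have qf1 : quasi D.+2 f1 by apply: quasi_term.
(* Besides the wanted top term, [f1] produces C(n,D-1) w(n+2), here expanded in u(n) and u(n+1);
   there is no such term for D = 0. *)
pose low n d := if D is i.+1 then 'C(n, i)%:R * (d%:R * (al d + be d) * (u d n)%:R
  + (al d + be d + d%:R * be d) * (u d n.+1)%:R) else 0.
have qlow : quasi D low.
  rewrite /low; case: (D) => [|i]; first exact: quasi0.
  by apply: quasi_term; rational.
have [f2 qf2 Hf2] := IH _ (quasi_sub qh qlow).
exists (fun n d => f1 n d + f2 n d); first by apply: quasi_add; last exact: quasiS.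
move=> n d d0; rewrite Hh // Tw // Hf2 // /f1 /low.
have -> : w d n.+2 = w d n.+1 + d%:R * w d n by rewrite /w !MshiftE; ring.
case: (D) => [|i].
  by rewrite !bin0 !bin1 -[n.+2]addn1 -[n.+1]addn1 !natrD; ring.
have -> : d%:R * (al d + be d) * (u d n)%:R +
   (al d + be d + d%:R * be d) * (u d n.+1)%:R = w d n.+1 + d%:R * w d n.
  by rewrite /w MshiftE; ring.
by rewrite !(binS _.+1 _) !(binS n) !natrD; ring.
Qed.

Lemma quasi_rational_at D g n : quasi D g -> rational_in_d (g n).
Proof.
elim: D g => [|D IH] g.
  by move=> H; exists 0, 1 => d d0; rewrite H // hornerC oner_eq0 horner0 mul0r.
move=> [a [b [g' [ra rb /IH rg' H]]]].
have [p [q E]] : rational_in_d (fun d => g' n d +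
    'C(n, D)%:R * (a d * (u d n)%:R + b d * (u d n.+1)%:R)).
  have rM i : rational_in_d (fun d => (u d i)%:R).
    elim/ltn_ind: i => -[|[|i]] IHi; try exact: rational_const.
    have [p [q E]] := rational_add (IHi i.+1 (leqnn _))
      (rational_mul rational_id (IHi i (leqW (leqnn _)))).
    by exists p, q => d /E; rewrite -MshiftE.
  have rn := rM n; have rnS := rM n.+1; rational.
by exists p, q => d d0; rewrite H //; exact: E.
Qed.

(** A solution differs from a particular one by a homogeneous solution a u(n) + b u(n+1). As u
    starts 0, 1, 1, its first two values are b and a + b, which fixes a and b. *)
Lemma quasi_recurrence D h f : quasi D h ->
  rational_in_d (f 0%N) -> rational_in_d (f 1%N) ->
  (forall n d, (0 < d)%N -> f n.+2 d = f n.+1 d + d%:R * f n d + h n d) ->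
  quasi D.+1 f.
Proof.
move=> qh rf0 rf1 Hf; have [g qg Hg] := quasi_recurrence_solvable qh.
have rg0 := quasi_rational_at 0 qg; have rg1 := quasi_rational_at 1 qg.
pose b d := f 0%N d - g 0%N d.
pose a d := f 1%N d - g 1%N d - b d.
have rb : rational_in_d b by rewrite /b; rational.
have ra : rational_in_d a by rewrite /a; rational.
apply: (@eq_quasi _ (fun n d => g n d +
  'C(n, 0)%:R * (a d * (u d n)%:R + b d * (u d n.+1)%:R))); last first.
  by apply: quasi_add => //; apply: quasi_term.
move=> n d d0; rewrite bin0 mul1r; elim/ltn_ind: n => -[|[|n]] IH.
- by rewrite /= /b; ring.
- by rewrite MshiftE /= /a; ring.
- rewrite Hf // Hg // -!IH //.
  by rewrite !(MshiftE d) ; ring.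
Qed.

(** * Passage to polynomials in n over Q(d) *)

Definition polyfun (D : nat) (f : nat -> nat -> rat) : Prop :=
  exists2 c : nat -> nat -> rat, forall i, rational_in_d (c i) &
    forall n d, (0 < d)%N -> f n d = \sum_(i < D) c i d * n%:R ^+ i.

Lemma polyfun0 D : polyfun D (fun _ _ => 0).
Proof.
exists (fun _ _ => 0); first by move=> i; exact: rational_const.
by move=> n d _; rewrite big1 // => i _; rewrite mul0r.
Qed.

Lemma polyfun_add D f g : polyfun D f -> polyfun D g ->
  polyfun D (fun n d => f n d + g n d).
Proof.
move=> [c rc Hf] [e re Hg]; exists (fun i d => c i d + e i d).
  by move=> i; apply: rational_add.
move=> n d d0; rewrite Hf // Hg // -big_split.
by apply: eq_bigr => i _; rewrite mulrDl.
Qed.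

Lemma polyfun_term D r (p : {poly rat}) : rational_in_d r -> (size p <= D)%N ->
  polyfun D (fun n d => r d * p.[n%:R]).
Proof.
move=> rr sp; exists (fun i d => r d * p`_i).
  by move=> i; rational.
move=> n d _; rewrite (horner_coef_wide _ sp) mulr_sumr.
by apply: eq_bigr => i _; rewrite mulrA.
Qed.

Lemma polyfun_eval D f : polyfun D f -> exists2 A : {poly ratfun},
  (size A <= D)%N & forall n d, (0 < d)%N ->
    regular_at A d%:R /\ eval_at A n%:R d%:R = f n d.
Proof.
move=> [c rc Hf].
have [p Hp] := choice (fun i => let: ex_intro p (ex_intro q H) := rc i in
  ex_intro (fun x : {poly rat} * {poly rat} => forall d, (0 < d)%N ->
    x.2.[d%:R] != 0 /\ c i d = x.1.[d%:R] / x.2.[d%:R]) (p, q) H).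
pose F x := @FracField.tofrac {poly rat} x.
(* The coefficients from D on are 0 and must be regular as well; moreover [map_poly] acts
   coefficientwise only when 0 is sent to 0. Writing 0 as 0/1 gives both. *)
have ev0 (x : rat) : rf_regular 0 x /\ rf_eval 0 x = 0.
  have [] := @rf_evalE 0 1 x; first by rewrite hornerC oner_eq0.
  by rewrite rmorph0 mul0r horner0 mul0r.
exists (\poly_(i < D) (F (p i).1 / F (p i).2)); first exact: size_poly.
move=> n d d0; split.
  move=> i; rewrite coef_poly; case: ifP => _; last exact: (ev0 _).1.
  by have [q0 _] := Hp i d d0; exact: (rf_evalE _ q0).1.
rewrite /eval_at Hf //.
rewrite (@horner_coef_wide _ D); last first.
  by apply: (leq_trans (size_poly _ _)); exact: size_poly.
apply: eq_bigr => i _; rewrite coef_map_id0 ?coef_poly ?ltn_ord; last exact: (ev0 _).2.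
by have [q0 ->] := Hp i d d0; rewrite (rf_evalE _ q0).2.
Qed.

Lemma quasi_polyfun D g : quasi D g -> exists A B, [/\ polyfun D A, polyfun D B &
  forall n d, (0 < d)%N ->
    g n d = A n.+1 d * (M d n.+1)%:R + B n.+1 d * (M d n.+2)%:R].
Proof.
rewrite /M.
(* The bound E stays fixed during the induction on D, so that all summands share it. *)
suff H E : quasi D g -> (D <= E)%N -> exists A B, [/\ polyfun E A, polyfun E B &
  forall n d, (0 < d)%N ->
    g n d = A n.+1 d * (M d n.+1)%:R + B n.+1 d * (M d n.+2)%:R].
  by move=> /H; apply.
elim: D g => [|D IH] g.
  move=> H _; exists (fun _ _ => 0), (fun _ _ => 0).
  by split; do ?exact: polyfun0; move=> n d d0; rewrite H // !mul0r addr0.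
move=> [a [b [g' [ra rb qg' H]]]] DE; have [A [B [pA pB HAB]]] := IH _ qg' (ltnW DE).
(* [P] is shifted so that its value at n + 1 is C(n,D). *)
pose P := binpoly D \Po ('X - 1%:P).
have sP : (size P <= E)%N.
  apply: leq_trans DE; apply: (leq_trans (size_comp_poly_leq _ _)).
  by rewrite size_XsubC muln1 ltnS -subn1 leq_subLR add1n size_binpoly.
(* Coefficients of a u(n) + b u(n+1) on u(n+2) = M(n+1) and u(n+3) = M(n+2). *)
pose al d : rat := a d * ((d%:R + 1) * (d%:R^-1 * d%:R^-1)) - b d * d%:R^-1.
pose be d : rat := b d * d%:R^-1 - a d * (d%:R^-1 * d%:R^-1).
have ral : rational_in_d al by rewrite /al; rational.
have rbe : rational_in_d be by rewrite /be; rational.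
exists (fun n d => A n d + al d * P.[n%:R]), (fun n d => B n d + be d * P.[n%:R]).
split; do ?by apply: polyfun_add => //; apply: polyfun_term.
move=> n d d0; rewrite H // HAB // /P horner_comp hornerXsubC.
rewrite -[n.+1%:R]natr1 addrK binpolyE /M !(MshiftE d) /al /be.
by field; rewrite pnatr_eq0 -lt0n.
Qed.

(** * Runner lists and their weights *)

(* Runner lengths [c_0; ...; c_(m-2)]; the index m = n + 1 lets the recursion
   start from an empty sum, like that of [Mshift]. *)
Fixpoint runners (d m : nat) : seq (seq nat) :=
  match m with
  | 0 => [::]
  | 1 => [:: [::]]
  | (m''.+1 as m').+1 => [seq rcons l 0%N | l <- runners d m'] ++
      [seq rcons (rcons l 0%N) j | l <- runners d m'', j <- iota 1 d]
  end.

Lemma size_runners d m l : l \in runners d m -> m = (size l).+1.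
Proof.
elim/ltn_ind: m l => -[|[|m]] IH l; first by rewrite in_nil.
  by rewrite mem_seq1 => /eqP ->.
rewrite [runners _ _]/= -/(runners d m.+1) mem_cat.
case/orP=> [/mapP[l' l'm ->]|/allpairsP[[l' j] [/= l'm _ ->]]].
  by rewrite size_rcons -(IH _ _ _ l'm).
by rewrite !size_rcons -(IH _ _ _ l'm) // leqW.
Qed.

Lemma big_runnersSS (V : nmodType) d m (f : seq nat -> V) :
  \sum_(l <- runners d m.+2) f l = \sum_(l <- runners d m.+1) f (rcons l 0%N)
    + \sum_(l <- runners d m) \sum_(j <- iota 1 d) f (rcons (rcons l 0%N) j).
Proof. by rewrite [runners _ _]/= big_cat big_map big_allpairs_dep. Qed.

Definition wP (l : seq nat) : nat := \sum_(r < size l) r * nth 0 l r.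
Definition wQ (l : seq nat) : nat := \sum_(r < size l) 'C(nth 0 l r, 2).
Definition wS (l : seq nat) : nat := \sum_(r < size l) nth 0 l r.

Lemma sum_nth_rcons (F : nat -> nat -> nat) l x :
  (\sum_(r < size (rcons l x)) F r (nth 0 (rcons l x) r) =
   \sum_(r < size l) F r (nth 0 l r) + F (size l) x)%N.
Proof.
rewrite size_rcons big_ord_recr /= nth_rcons ltnn eqxx; congr (_ + _)%N.
by apply: eq_bigr => r _; rewrite nth_rcons ltn_ord.
Qed.

Lemma wP_rcons l x : wP (rcons l x) = (wP l + size l * x)%N.
Proof. exact: (sum_nth_rcons (fun r x => r * x)%N). Qed.

Lemma wQ_rcons l x : wQ (rcons l x) = (wQ l + 'C(x, 2))%N.
Proof. exact: (sum_nth_rcons (fun r x => 'C(x, 2))). Qed.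

Lemma wS_rcons l x : wS (rcons l x) = (wS l + x)%N.
Proof. exact: (sum_nth_rcons (fun r x => x)). Qed.

Lemma bin2_rat j : 'C(j, 2)%:R = (j%:R ^+ 2 - j%:R) / 2 :> rat.
Proof.
elim: j => [|j IH]; first by rewrite bin0n expr0n subrr mul0r.
rewrite binS bin1 natrD IH -[j.+1%:R]natr1. by field.
Qed.

Definition weight a b e (l : seq nat) : rat :=
  (wP l)%:R ^+ a * (wQ l)%:R ^+ b * (wS l)%:R ^+ e.

(* The weight of m, Q, S is 1 and that of P is 2, bounding their growth in the
   number of runners; j is the length of a single runner and has weight 0. *)
Inductive spn (D : nat) : (nat -> nat -> seq nat -> rat) -> Prop :=
| spn_gen z y a b e : (y + (2 * a + b + e) < D)%N ->
    spn D (fun m j l => 'C(j, z)%:R * (m%:R ^+ y * weight a b e l))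
| spn0 : spn D (fun _ _ _ => 0)
| spn_add f g : spn D f -> spn D g -> spn D (fun m j l => f m j l + g m j l)
| spn_scale c f : spn D f -> spn D (fun m j l => c * f m j l)
| spn_eq f g : (forall m j l, f m j l = g m j l) -> spn D f -> spn D g.

Lemma spn_opp D f : spn D f -> spn D (fun m j l => - f m j l).
Proof.
by move/(spn_scale (-1)); apply: spn_eq => m j l; rewrite mulN1r.
Qed.

Lemma spn_sub D f g : spn D f -> spn D g -> spn D (fun m j l => f m j l - g m j l).
Proof. by move=> sf /spn_opp; apply: spn_add. Qed.

Lemma spn_leq D E f : (D <= E)%N -> spn D f -> spn E f.
Proof.
move=> DE; elim=> [z y a b e lt||f1 g _ sf _ sg|c f1 _ sf|f1 g eq _ sf].
- by apply: spn_gen; apply: leq_trans lt DE.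
- exact: spn0.
- exact: spn_add.
- exact: spn_scale.
- exact: spn_eq eq sf.
Qed.

(** Multiplication by [h] is linear, so its cost in weight need only be checked on generators. *)
Lemma spn_mul D E (h : nat -> nat -> seq nat -> rat) f :
  (forall z y a b e, (y + (2 * a + b + e) < D)%N ->
    spn E (fun m j l => h m j l * ('C(j, z)%:R * (m%:R ^+ y * weight a b e l)))) ->
  spn D f -> spn E (fun m j l => h m j l * f m j l).
Proof.
move=> H; elim=> [z y a b e lt||f1 g _ sf _ sg|c f1 _ sf|f1 g eq _ sf].
- exact: H.
- by apply: spn_eq (spn0 _) => m j l; rewrite mulr0.
- by apply: spn_eq (spn_add sf sg) => m j l; rewrite mulrDr.
- by apply: spn_eq (spn_scale c sf) => m j l; rewrite mulrCA.
- by apply: spn_eq sf => m j l; rewrite eq.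
Qed.

(** Only the binomial index moves, by j C(j,z) = (z+1) C(j,z+1) + z C(j,z), and that index carries
    no weight. *)
Lemma spn_mulj D f : spn D f -> spn D (fun m j l => j%:R * f m j l).
Proof.
apply: spn_mul => z y a b e lt.
have g x := @spn_gen D x y a b e lt.
apply: spn_eq (spn_add (spn_scale z.+1%:R (g z.+1)) (spn_scale z%:R (g z))) => m j l.
rewrite [RHS]mulrA -natrM; have -> : (j * 'C(j, z) = z.+1 * 'C(j, z.+1) + z * 'C(j, z))%N.
  rewrite mul_bin_left; case: (leqP z j) => [le|lt']; last by rewrite bin_small // !muln0.
  by rewrite -mulnDl subnK.
by rewrite natrD !natrM; ring.
Qed.

Lemma spn_mulm D f : spn D f -> spn D.+1 (fun m j l => m%:R * f m j l).
Proof.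
apply: spn_mul => z y a b e lt.
have := @spn_gen D.+1 z y.+1 a b e; rewrite addSn ltnS => /(_ lt).
by apply: spn_eq => m j l; rewrite exprS; ring.
Qed.

Lemma spn_mulP D f : spn D f -> spn D.+2 (fun m j l => (wP l)%:R * f m j l).
Proof.
apply: spn_mul => z y a b e lt.
have lt' : (y + (2 * a.+1 + b + e) < D.+2)%N by lia.
by apply: spn_eq (spn_gen z lt') => m j l; rewrite /weight exprS; ring.
Qed.

Lemma spn_mulQ D f : spn D f -> spn D.+1 (fun m j l => (wQ l)%:R * f m j l).
Proof.
apply: spn_mul => z y a b e lt.
have lt' : (y + (2 * a + b.+1 + e) < D.+1)%N by lia.
by apply: spn_eq (spn_gen z lt') => m j l; rewrite /weight exprS; ring.
Qed.

Lemma spn_mulS D f : spn D f -> spn D.+1 (fun m j l => (wS l)%:R * f m j l).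
Proof.
apply: spn_mul => z y a b e lt.
have lt' : (y + (2 * a + b + e.+1) < D.+1)%N by lia.
by apply: spn_eq (spn_gen z lt') => m j l; rewrite /weight exprS; ring.
Qed.

Lemma spn_mulbin D f : spn D f -> spn D (fun m j l => 'C(j, 2)%:R * f m j l).
Proof.
move=> sf; have sj := spn_mulj sf.
apply: spn_eq (spn_scale 2^-1 (spn_sub (spn_mulj sj) sj)) => m j l.
by rewrite bin2_rat; field.
Qed.

Lemma spn_weight a b e : spn (2 * a + b + e).+1 (fun _ _ l => weight a b e l).
Proof.
have lt : (0 + (2 * a + b + e) < (2 * a + b + e).+1)%N by [].
by apply: spn_eq (spn_gen 0 lt) => m j l; rewrite bin0 !mul1r.
Qed.

(* The weight of [rcons (rcons l 0) j] for l in [runners d m]. *)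
Definition peeled_weight a b e m j l : rat :=
  ((wP l)%:R + m%:R * j%:R) ^+ a * ((wQ l)%:R + 'C(j, 2)%:R) ^+ b
  * ((wS l)%:R + j%:R) ^+ e.

(** Factors are added one at a time by (x + y) p' - x p = x (p' - p) + y (p' - p) + y p. The
    increment y is m j for P, of weight 1 instead of 2, and has weight 0 instead of 1 for Q and S;
    hence the difference has weight strictly below 2a + b + e. *)
Lemma spn_peeled a b e : spn (2 * a + b + e)
  (fun m j l => peeled_weight a b e m j l - weight a b e l).
Proof.
elim: a => [|a IH].
  elim: b => [|b IH].
    elim: e => [|e IH].
      apply: spn_eq (spn0 _) => m j l.
      by rewrite /peeled_weight /weight !expr0 subrr.
    have sw := spn_weight 0 0 e.
    have := spn_add (spn_add (spn_mulS IH) (spn_leq (leqnSn _) (spn_mulj IH)))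
      (spn_mulj sw).
    rewrite -addnS; apply: spn_eq => m j l.
    by rewrite /peeled_weight /weight !exprS; ring.
  have sw := spn_weight 0 b e.
  have := spn_add (spn_add (spn_mulQ IH) (spn_leq (leqnSn _) (spn_mulbin IH)))
    (spn_mulbin sw).
  rewrite -addSn -addnS; apply: spn_eq => m j l.
  by rewrite /peeled_weight /weight !exprS; ring.
have sw := spn_weight a b e.
have := spn_add (spn_add (spn_mulP IH)
  (spn_leq (leqnSn _) (spn_mulm (spn_mulj IH)))) (spn_mulm (spn_mulj sw)).
have -> : (2 * a.+1 + b + e = (2 * a + b + e).+2)%N by lia.
apply: spn_eq => m j l.
by rewrite /peeled_weight /weight !exprS; ring.
Qed.

Lemma rational_bin z : rational_in_d (fun d => 'C(d, z)%:R).
Proof.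
by have [p [q H]] := rational_poly (binpoly z); exists p, q => d /H; rewrite binpolyE.
Qed.

(** Hockey-stick identity; C(0,z) is subtracted because j starts at 1. *)
Lemma rational_sum_bin z : rational_in_d (fun d => \sum_(j <- iota 1 d) 'C(j, z)%:R).
Proof.
have E d : \sum_(j <- iota 1 d) 'C(j, z)%:R =
    'C(d, z)%:R + 'C(d, z.+1)%:R - 'C(0, z)%:R :> rat.
  elim: d => [|d IH]; first by rewrite big_nil (bin0n z.+1) addr0 subrr.
  rewrite -[d.+1]addn1 iotaD big_cat big_seq1 IH addn1 add1n.
  case: z {IH} => [|z] /=; first by rewrite !bin0 !bin1 -[d.+1%:R]natr1; ring.
  by rewrite !(binS d) !natrD; ring.
have rz := rational_bin z; have rzS := rational_bin z.+1.
have [p [q H]] : rational_in_d (fun d => 'C(d, z)%:R + 'C(d, z.+1)%:R - 'C(0, z)%:R).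
  by rational.
by exists p, q => d /H; rewrite E.
Qed.

(** * Weight sums and power sums over runner lists *)

Definition weight_sum a b e m d : rat := \sum_(l <- runners d m) weight a b e l.

(** On a generator the sum over j factors out and leaves m^y times a weight sum. Weight sums are
    assumed quasi-polynomial only below weight D, so that the induction hypothesis of
    [quasi_weight_sum] fits. *)
Lemma quasi_spn_sum D (js : nat -> seq nat) f :
  (forall z, rational_in_d (fun d => \sum_(j <- js d) 'C(j, z)%:R)) ->
  (forall a b e, (2 * a + b + e < D)%N ->
    quasi (2 * a + b + e).+1 (weight_sum a b e)) ->
  spn D f ->
  quasi D (fun m d => \sum_(l <- runners d m) \sum_(j <- js d) f m j l).
Proof.
move=> rjs HW; elim=> [z y a b e lt||f1 g _ sf _ sg|c f1 _ sf|f1 g eq _ sf].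
- apply: (@eq_quasi _ (fun m d => (\sum_(j <- js d) 'C(j, z)%:R) *
    (m%:R ^+ y * weight_sum a b e m d))); last first.
    apply: quasi_scale => //; apply: (quasi_leq lt); rewrite -addnS.
    by apply/quasi_muln_exp/HW; apply: leq_ltn_trans lt; exact: leq_addl.
  move=> m d _; rewrite exchange_big mulr_suml; apply: eq_bigr => j _.
  by rewrite !mulr_sumr.
- by apply: eq_quasi (quasi0 _) => m d _; rewrite big1 // => l _; rewrite big1.
- apply: eq_quasi (quasi_add sf sg) => m d _ /=; rewrite -big_split.
  by apply: eq_bigr => l _; rewrite big_split.
- apply: eq_quasi (quasi_scale (rational_const c) sf) => m d _.
  by rewrite mulr_sumr; apply: eq_bigr => l _; rewrite mulr_sumr.
- apply: eq_quasi sf => m d _; apply: eq_bigr => l _.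
  by apply: eq_bigr => j _; exact: eq.
Qed.

(** Strong induction on the weight. A final 0 leaves P, Q and S unchanged; for the endings 0, j with
    1 <= j <= d, taking out d copies of the old weight leaves [h], made of smaller weights. *)
Lemma quasi_weight_sum a b e : quasi (2 * a + b + e).+1 (weight_sum a b e).
Proof.
have [D] := ubnP (2 * a + b + e); elim: D a b e => // D IH a b e.
rewrite ltnS => leD.
pose h m d := \sum_(l <- runners d m) \sum_(j <- iota 1 d)
  (peeled_weight a b e m j l - weight a b e l).
have qh : quasi (2 * a + b + e) h.
  apply: quasi_spn_sum (spn_peeled a b e); first exact: rational_sum_bin.
  by move=> a' b' e' lt; apply: IH; exact: leq_trans lt leD.
apply: (quasi_recurrence qh).
- by exists 0, 1 => d _; rewrite hornerC oner_eq0 horner0 mul0r [LHS]big_nil.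
- by have [p [q H]] := rational_const (weight a b e [::]); exists p, q => d /H;
    rewrite /weight_sum big_seq1.
move=> m d _; rewrite /weight_sum big_runnersSS -addrA; congr (_ + _).
  apply: eq_bigr => l _; rewrite /weight wP_rcons wQ_rcons wS_rcons.
  by rewrite muln0 !addn0.
rewrite mulr_sumr -big_split /=; rewrite !big_seq; apply: eq_bigr => l lm.
have E : d%:R * weight a b e l = \sum_(j <- iota 1 d) weight a b e l.
  by rewrite big_const_seq count_predT size_iota iter_addr_0 mulr_natl.
rewrite E -big_split; apply: eq_bigr => j _ /=; rewrite addrC subrK.
rewrite /weight !(wP_rcons, wQ_rcons, wS_rcons) size_rcons -(size_runners lm).
by rewrite muln0 !addn0 !natrD natrM.
Qed.

(** The number of runners is a rational argument, so that it can be replaced by a polynomial in m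
    such as m - 1. *)
Definition runner_size (n : rat) (l : seq nat) : rat :=
  (wP l)%:R + n * (wQ l)%:R - ((wS l)%:R ^+ 2 - (wS l)%:R) / 2.

(** Source of the degree bound 2k: each factor of the size costs weight at most 2. *)
Lemma spn_exp h k :
  (forall D f, spn D f -> spn D.+2 (fun m j l => h m j l * f m j l)) ->
  spn (2 * k).+1 (fun m j l => h m j l ^+ k).
Proof.
move=> H; elim: k => [|k IH].
  by apply: spn_eq (spn_weight 0 0 0) => m j l; rewrite /weight !expr0 !mulr1.
by rewrite mulnS; apply: spn_eq (H _ _ IH) => m j l; rewrite exprS.
Qed.

Lemma quasi_runner_size k : quasi (2 * k).+1 (fun m d =>
  \sum_(l <- runners d m.+2) runner_size m.+1%:R l ^+ k).
Proof.
have sp : spn (2 * k).+1 (fun m _ l => runner_size (m%:R - 1) l ^+ k).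
  apply: spn_exp => D f sf.
  have sQ := spn_mulQ sf; have sS := spn_mulS sf.
  have s1 := spn_sub (spn_mulm sQ) (spn_leq (leqnSn _) sQ).
  have s2 := spn_scale (-2^-1) (spn_sub (spn_mulS sS) (spn_leq (leqnSn _) sS)).
  apply: spn_eq (spn_add (spn_add (spn_mulP sf) s1) s2) => m j l.
  by rewrite /runner_size; field.
(* The summand does not involve j, which therefore runs over one dummy value. *)
have r1 z : rational_in_d (fun=> \sum_(j <- [:: 0%N]) 'C(j, z)%:R).
  exact: rational_const.
have q := quasi_spn_sum r1 (fun a b e _ => quasi_weight_sum a b e) sp.
(* After two shifts m - 1 becomes m + 1, the length of the lists in [runners d m.+2]. *)
apply: eq_quasi (quasi_shift (quasi_shift q)) => m d _.
apply: eq_bigr => l _; rewrite big_seq1 -[m.+2]addn1 natrD addrK; exact: erefl.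
Qed.

(** These lists, with a last runner of length d, are the ones to be subtracted in the minus case. *)
Lemma quasi_runner_size_last k : quasi (2 * k).+1 (fun m d =>
  \sum_(l <- runners d m) runner_size m.+1%:R (rcons (rcons l 0%N) d) ^+ k).
Proof.
(* The size for the list ending in 0, j: the entry j sits at position m, and there are m + 1
   runners. *)
pose h m j l : rat := (wP l)%:R + m%:R * j%:R
  + (m%:R + 1) * ((wQ l)%:R + 'C(j, 2)%:R)
  - (((wS l)%:R + j%:R) ^+ 2 - ((wS l)%:R + j%:R)) / 2.
have sp : spn (2 * k).+1 (fun m j l => h m j l ^+ k).
  apply: spn_exp => D f sf.
  have sm : spn D.+2 (fun m j l => m%:R * j%:R * f m j l).
    apply: spn_eq (spn_leq (leqnSn _) (spn_mulm (spn_mulj sf))) => m j l.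
    by rewrite mulrA.
  have sQ := spn_add (spn_mulQ sf) (spn_leq (leqnSn _) (spn_mulbin sf)).
  have sS g E (sg : spn E g) :=
    spn_add (spn_mulS sg) (spn_leq (leqnSn _) (spn_mulj sg)).
  have s1 := spn_add (spn_mulm sQ) (spn_leq (leqnSn _) sQ).
  have s2 := spn_scale (-2^-1) (spn_sub (sS _ _ (sS _ _ sf))
    (spn_leq (leqnSn _) (sS _ _ sf))).
  apply: spn_eq (spn_add (spn_add (spn_add (spn_mulP sf) sm) s1) s2) => m j l.
  by rewrite /h; field.
have r1 z : rational_in_d (fun d => \sum_(j <- [:: d]) 'C(j, z)%:R).
  have [p [q H]] := rational_bin z; exists p, q => d /H; by rewrite big_seq1.
have q := quasi_spn_sum r1 (fun a b e _ => quasi_weight_sum a b e) sp.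
apply: eq_quasi q => m d _.
rewrite !big_seq; apply: eq_bigr => l lm; rewrite big_seq1; congr (_ ^+ _).
rewrite /runner_size /h !(wP_rcons, wQ_rcons, wS_rcons) size_rcons.
by rewrite -(size_runners lm) muln0 !addn0 !natrD natrM natr1.
Qed.

(** * Cores and distinct parts in terms of bead sets *)

Section BeadSets.
Local Open Scope nat_scope.

Lemma size_beta la : size (beta la) = size la.
Proof. by elim: la => //= a l ->. Qed.

Lemma beta_le a l x : sorted geq (a :: l) -> x \in beta l -> x < a + size l.
Proof.
elim: l a => // b l IH a sl; rewrite /= inE => /predU1P[->|xl].
  by have /andP[ba _] := sl; rewrite addnS ltnS leq_add2r.
have /andP[ba sl'] := sl; rewrite addnS ltnS.
by apply: leq_trans (ltnW (IH _ sl' xl)) _; rewrite leq_add2r.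
Qed.

Lemma sorted_beta la : sorted geq la -> sorted gtn (beta la).
Proof.
elim: la => // a l IH sl; rewrite /= path_min_sorted ?IH ?(path_sorted sl) //.
by apply/allP => x /(beta_le sl).
Qed.

Fixpoint unbeta (s : seq nat) : seq nat :=
  if s is b :: s' then (b - size s') :: unbeta s' else [::].

Lemma size_unbeta s : size (unbeta s) = size s.
Proof. by elim: s => //= b s ->. Qed.

Lemma unbetaK la : unbeta (beta la) = la.
Proof. by elim: la => //= a l ->; rewrite size_beta addnK. Qed.

Lemma sorted_gtn_size b s : sorted gtn (b :: s) -> size s <= b.
Proof.
elim: s b => //= c s IH b /andP[cb /IH] sc; exact: leq_ltn_trans sc cb.
Qed.

Lemma betaK s : sorted gtn s -> beta (unbeta s) = s.
Proof.
elim: s => //= b s IH sb; rewrite size_unbeta IH ?(path_sorted sb) // subnK //.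
exact: sorted_gtn_size.
Qed.

Lemma sorted_unbeta s : sorted gtn s -> sorted geq (unbeta s).
Proof.
elim: s => // b [|c s] IH // /andP[/= cb sc]; have /= -> := IH sc.
by rewrite andbT; lia.
Qed.

Lemma sumn_beta la : sumn (beta la) = sumn la + 'C(size la, 2).
Proof. by elim: la => //= a l ->; rewrite binS bin1; lia. Qed.

(** Converse to [beta_gap]: each column j gives a hole. The hook length of a first-row box in column
    j is the first bead minus the hole of that column for the remaining rows. *)
Lemma beta_hole l j : sorted geq l -> j + count (fun y => y <= j) l \notin beta l.
Proof.
elim: l => // b l IH sl; rewrite /= inE negb_or.
have sl' := path_sorted sl; have lb := sorted_head sl.
case: (leqP b j) => [bj|jb].
  have -> : count (fun y => y <= j) l = size l.
    by apply/eqP; rewrite -all_count; apply: sub_all lb => y yb; apply: leq_trans yb bj.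
  apply/andP; split; first by apply/eqP; lia.
  by apply/negP => /(beta_le sl); lia.
rewrite add0n IH // andbT; have := count_size (fun y => y <= j) l.
by move=> ?; apply/eqP; lia.
Qed.

Definition sub_closed (t : nat) (s : seq nat) : Prop :=
  forall x, x \in s -> t <= x -> x - t \in s.

(** If a first-row hook length were k t, then k steps of length t down from the first bead would
    stay among the beads by closure, yet end at a hole of the remaining rows. Lower rows follow by
    induction. *)
Lemma core_sub_closed t la : sorted geq la ->
  is_core t la <-> sub_closed t (beta la).
Proof.
case: (posnP t) => [->|t0] sl.
  split=> [_ x xs _|_ i j _]; first by rewrite subn0.
  by rewrite dvd0n.
elim: la sl => [|a l IH] sl; first by split=> [_ x|_ i j]; rewrite ?in_nil.
have sl' := path_sorted sl; split=> co.
  have /(IH sl') cl := core_cons co.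
  move=> x; rewrite inE => /predU1P[-> tx|xl tx].
    by rewrite inE (beta_hook sl co t0 tx) orbT.
  by rewrite inE cl ?orbT.
have cl : sub_closed t (beta l).
  move=> x xl tx; have := co x; rewrite inE xl orbT => /(_ isT tx).
  rewrite inE => /predU1P[E|//]; have := beta_le sl xl; lia.
have head_closed k : k * t <= a + size l -> a + size l - k * t \in beta (a :: l).
  elim: k => [|k IHk] le; first by rewrite mul0n subn0 mem_head.
  rewrite mulSnr subnDA; apply: co; first by apply: IHk; lia.
  by lia.
move=> [|i] j; last exact: (IH sl').2 cl i j.
rewrite /is_box /= => ja; apply/negP => /dvdnP[k E].
have hE : a + size l - k * t = j + count (fun y => y <= j) l.
  rewrite -E /hook /arm /leg /= drop0.
  have := count_predC (fun y => y <= j) l.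
  have -> : count (predC (fun y => y <= j)) l = count (fun y => j < y) l.
    by apply: eq_count => y; rewrite /= -ltnNge.
  lia.
have kt : k * t <= a + size l.
  by rewrite -E /hook /arm /leg /= drop0; have := count_size (fun y => j < y) l; lia.
(* The only bead left is the first one itself, which would make the hook length 0. *)
have := head_closed k kt; rewrite hE inE (negPf (beta_hole j sl')) orbF => /eqP.
by move: E hE; rewrite /hook; lia.
Qed.

(** A bead is a part plus the number of rows below it, so equal adjacent parts are exactly beads at
    distance 1. *)
Lemma uniq_beta la : sorted geq la ->
  uniq la <-> (forall x, x \in beta la -> x.+1 \notin beta la).
Proof.
elim: la => // a l IH sl; have sl' := path_sorted sl; split=> [/andP[al ul]|H].
  move=> x; rewrite inE => /predU1P[->|xl].
    rewrite inE negb_or; apply/andP; split.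
      by apply/eqP; rewrite -[size _]/(size l); lia.
    by apply/negP => /(beta_le sl); lia.
  rewrite inE negb_or ((IH sl').1 ul) // andbT; apply/eqP => E.
  case: l al sl sl' ul xl E {IH} => // b l; rewrite inE negb_or => /andP[/eqP nab _].
  move=> /andP[/= ba sl] _ _; rewrite inE => /predU1P[->|/(beta_le sl)] /=; lia.
rewrite /= (IH sl').2 ?andbT.
  apply/negP; case: l sl sl' H {IH} => // b l /andP[/= ba sl] sl' H.
  rewrite inE => ab; have {ab} E : a = b.
    apply/eqP; rewrite eqn_leq ba andbT; case/predU1P: ab => [->//|].
    exact: (allP (sorted_head sl')).
  by have := H (b + size l); rewrite /= !inE E addnS !eqxx orbT => /(_ isT).
move=> x xl; have := H x; rewrite !inE xl orbT => /(_ isT).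
by rewrite negb_or => /andP[].
Qed.

Lemma zero_beta la : sorted geq la -> (0 \in la) = (0 \in beta la).
Proof.
elim: la => // a l IH sl; rewrite /= !inE -IH ?(path_sorted sl) //.
case: (boolP (0 \in l)) => [_|l0]; rewrite ?orbT ?orbF //.
case: l sl l0 {IH} => [|b l] sl l0; first by rewrite addn0.
have /andP[/= ba _] := sl; move: l0; rewrite inE negb_or => /andP[b0 _]; lia.
Qed.

(** * Spaced runner lists and their bead sets *)

Lemma nth_rcons0 l r : nth 0 (rcons l 0) r = nth 0 l r.
Proof.
by rewrite nth_rcons; case: ltnP => // le; rewrite if_same nth_default.
Qed.

Lemma nth_rcons0j l j r :
  nth 0 (rcons (rcons l 0) j) r = if r == (size l).+1 then j else nth 0 l r.
Proof.
rewrite nth_rcons size_rcons nth_rcons0; case: ltngtP => // gt.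
by rewrite nth_default // ltnW // ltnW.
Qed.

(** Beyond the end the default value 0 leaves the last runner free on its right. Its true neighbour
    is runner 0 one level higher, which is empty. *)
Definition spaced (l : seq nat) : Prop :=
  nth 0 l 0 = 0 /\ forall r, nth 0 l r = 0 \/ nth 0 l r.+1 = 0.

(** A nonzero last entry must be preceded by 0, so a spaced list ends in 0 or in 0, j with j > 0:
    the two branches of the recursion. *)
Lemma runnersP d m l : l \in runners d m.+1 <->
  [/\ size l = m, spaced l & forall r, nth 0 l r <= d].
Proof.
elim/ltn_ind: m l => -[|m] IH l.
  rewrite mem_seq1; split=> [/eqP -> | [/size0nil -> //]].
  by split=> //; [split=> // r; left | move=> r]; rewrite nth_nil.
rewrite [runners _ _]/= -/(runners d m.+1) mem_cat; split.
  case/orP=> [/mapP[l' /(IH m (ltnSn _)) [sz [l0 sp] le] ->]|].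
    split; first by rewrite size_rcons sz.
      by split=> [|r]; rewrite !nth_rcons0.
    by move=> r; rewrite nth_rcons0.
  case/allpairsP=> -[l' j] /= [l'm]; rewrite mem_iota add1n ltnS => /andP[j0 jd] ->.
  case: m l'm IH => // m l'm IH.
  have [sz [l0 sp] le] := (IH m (leqW (ltnSn _)) _).1 l'm.
  split; first by rewrite !size_rcons sz.
    split=> [|r]; rewrite !nth_rcons0j //.
    have [->|] := eqVneq r (size l'); first by left; rewrite ltn_eqF // nth_default.
    rewrite eqSS => /negPf ->; case: eqVneq => // ->; right.
    by rewrite nth_default // ltnW.
  by move=> r; rewrite nth_rcons0j; case: ifP.
case; case/lastP: l => // l x; rewrite size_rcons => -[sz] [l0 sp] le.
case: (posnP x) => [x0|x0].
  move: l0 sp le; rewrite {}x0 => l0 sp le.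
  apply/orP; left; apply: (map_f (rcons^~ 0)).
  apply/(IH m (ltnSn _)); split=> //; first split.
  - by rewrite -nth_rcons0.
  - by move=> r; rewrite -!(nth_rcons0 l).
  - by move=> r; rewrite -nth_rcons0.
apply/orP; right; move: sz x0 l0 sp le.
(* In a list of length one the last entry is c_0, which is 0. *)
case/lastP: l => [|l y] sz x0 l0 sp le; first by have /= E := l0; rewrite E in x0.
move: sz; rewrite size_rcons => sz.
have y0 : y = 0.
  have := sp (size l); rewrite !nth_rcons !size_rcons !ltnSn !ltnn !eqxx.
  by case=> // E; rewrite E in x0.
move: l0 sp le; rewrite {}y0 -sz => l0 sp le.
apply/allpairsP; exists (l, x); split=> //=; last first.
  rewrite mem_iota x0 add1n ltnS.
  by have := le (size l).+1; rewrite nth_rcons0j eqxx.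
have E r : r <= size l -> nth 0 (rcons (rcons l 0) x) r = nth 0 l r.
  by move=> rl; rewrite nth_rcons0j ltn_eqF.
apply/(IH (size l)); first by rewrite -sz ltnW.
split=> //; first split; first by rewrite -E.
  move=> r; case: (ltnP r (size l)) => rl; last by left; rewrite nth_default.
  by rewrite -(E r (ltnW rl)) -(E r.+1 rl).
move=> r; case: (leqP r (size l)) => rl; first by rewrite -E.
by rewrite nth_default // ltnW.
Qed.

Lemma uniq_runners d m : uniq (runners d m).
Proof.
elim/ltn_ind: m => -[|[|m]] IH //.
rewrite [runners _ _]/= -/(runners d m.+1) cat_uniq map_inj_uniq; last first.
  by move=> l l' /rcons_inj[->].
rewrite IH //=; apply/andP; split.
  apply/hasPn => _ /allpairsP[[l j] /= [_ j1 ->]]; apply/negP => /mapP[l' _].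
  by move=> /rcons_inj[_ E]; rewrite E mem_iota in j1.
apply: allpairs_uniq_dep; [exact/IH/leqW | by move=> l _; exact: iota_uniq |].
by move=> [l j] [l' j'] _ _ /= /rcons_inj[/rcons_inj[->] ->].
Qed.

(** Every runner modulo [size l] is filled from the bottom; sorting yields the decreasing list that
    [unbeta] expects. *)
Definition beads (l : seq nat) : seq nat :=
  sort geq [seq q * size l + r | r <- iota 0 (size l), q <- iota 0 (nth 0 l r)].

Lemma divmod_inj n q r q' r' : r < n -> r' < n ->
  q * n + r = q' * n + r' -> q = q' /\ r = r'.
Proof.
move=> rn rn' E; have n0 : 0 < n by apply: leq_trans rn.
have := congr1 (divn^~ n) E; have := congr1 (modn^~ n) E.
by rewrite /= !modnMDl !divnMDl // !modn_small // !divn_small // !addn0.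
Qed.

Lemma uniq_beads l : uniq (beads l).
Proof.
rewrite sort_uniq; apply: allpairs_uniq_dep.
- exact: iota_uniq.
- by move=> r _; exact: iota_uniq.
- move=> [r q] [r' q'] /allpairsPdep[r1 [q1 [r1n _ E]]].
  move=> /allpairsPdep[r2 [q2 [r2n _ E']]] /=.
  have -> : r = r1 by have /= := congr1 tag E.
  have -> : r' = r2 by have /= := congr1 tag E'.
  move: r1n r2n; rewrite !mem_iota /= !add0n => r1n r2n.
  by move=> /(divmod_inj r1n r2n)[-> ->].
Qed.

Lemma mem_beads l q r : r < size l ->
  (q * size l + r \in beads l) = (q < nth 0 l r).
Proof.
move=> rn; rewrite mem_sort; apply/allpairsPdep/idP => [[r' [q' []]]|qr].
  by rewrite !mem_iota /= !add0n => r'n q'r /(divmod_inj rn r'n)[-> ->].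
by exists r, q; rewrite !mem_iota.
Qed.

Lemma mem_beadsP l x : x \in beads l ->
  exists q r, [/\ r < size l, q < nth 0 l r & x = q * size l + r].
Proof.
rewrite mem_sort => /allpairsPdep[r [q []]]; rewrite !mem_iota /= !add0n => rn qr ->.
by exists q, r.
Qed.

Lemma sorted_beads l : sorted gtn (beads l).
Proof.
by rewrite gtn_sorted_uniq_geq uniq_beads sort_sorted // => x y; exact: leq_total.
Qed.

Lemma size_beads l : size (beads l) = wS l.
Proof.
rewrite size_sort size_allpairs_dep sumnE big_map /wS -[X in iota 0 X]subn0.
by rewrite big_mkord; apply: eq_bigr => r _; rewrite size_iota.
Qed.

Lemma sumn_beads l : sumn (beads l) = wP l + size l * wQ l.
Proof.
rewrite (perm_sumn (permEl (perm_sort _ _))) sumnE big_allpairs_dep.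
rewrite /wP /wQ big_distrr -big_split -[X in iota 0 X]subn0 big_mkord.
apply: eq_bigr => r _ /=; rewrite big_split /= -big_distrl /=.
rewrite big_const_seq count_predT size_iota iter_addn_0 addnC; congr (_ + _).
by rewrite mulnC -[X in iota 0 X]subn0 -bin2_sum big_mkord.
Qed.

Definition partition_of (l : seq nat) : seq nat := unbeta (beads l).

Lemma sumn_partition_of l :
  (sumn (partition_of l))%:R = runner_size (size l)%:R l.
Proof.
have := sumn_beta (partition_of l).
rewrite /partition_of betaK ?sorted_beads // size_unbeta size_beads sumn_beads.
move/(congr1 (fun n => n%:R : rat)); rewrite !natrD natrM bin2_rat => E.
by rewrite /runner_size E; ring.
Qed.

Lemma partition_of_inj d n : 0 < n ->
  {in runners d n.+1 &, injective partition_of}.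
Proof.
move=> n0 l l' /runnersP[sz _ _] /runnersP[sz' _ _] /(congr1 beta).
rewrite !betaK ?sorted_beads // => E; apply: (@eq_from_nth _ 0); first by rewrite sz.
move=> r rn; have H q : (q < nth 0 l r) = (q < nth 0 l' r).
  by rewrite -!mem_beads ?sz' -?sz // E.
by apply/eqP; rewrite eqn_leq leqNgt H ltnn leqNgt -H ltnn.
Qed.

Lemma dcoresE s t la : (la \in dcores s t) = `[< [/\ sorted geq la,
  0 \notin beta la, forall x, x \in beta la -> x.+1 \notin beta la,
  sub_closed s (beta la) & sub_closed t (beta la)] >].
Proof.
apply/idP/asboolP; rewrite inE /dcores /=.
  move=> [/andP[sl l0] ul cs ct]; split=> //.
  - by rewrite -zero_beta.
  - exact/uniq_beta.
  - exact/core_sub_closed.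
  - exact/core_sub_closed.
move=> [sl l0 ul cs ct]; split.
- by rewrite /is_partition sl zero_beta.
- exact/uniq_beta.
- exact/core_sub_closed.
- exact/core_sub_closed.
Qed.

(** By closure no bead lies above an empty position, so c_r is the first empty position of runner r;
    one exists because beads are bounded by their sum. *)
Lemma sub_closed_runners n s : 0 < n -> sub_closed n s ->
  exists c : nat -> nat, forall q r, (q * n + r \in s) = (q < c r).
Proof.
move=> n0 cl.
have le_sum x : x \in s -> x <= sumn s.
  elim: (s) => //= y t IH; rewrite inE => /predU1P[->|/IH]; first exact: leq_addr.
  by move=> h; apply: leq_trans h (leq_addl _ _).
have ex r : exists q, q * n + r \notin s.
  exists (sumn s).+1; apply/negP => /le_sum; nia.
exists (fun r => ex_minn (ex r)) => q r; case: ex_minnP => c cs min.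
case: (ltnP q c) => [qc|]; first by apply/negPn/negP => /min; rewrite leqNgt qc.
move=> /subnKC <-; elim: (q - c) => [|k IH]; first by rewrite addn0; exact: negPf.
apply/negP => /cl; rewrite addnS mulSn -addnA leq_addr addKn IH.
by move=> /(_ isT).
Qed.

Lemma spaced_beads l x : spaced l -> x \in beads l -> x.+1 \notin beads l.
Proof.
move=> sp /mem_beadsP[q [r [rn qr ->]]]; rewrite -addnS.
have [rn' | rn'] := ltnP r.+1 (size l).
  by rewrite mem_beads //; have [E|->] := sp.2 r; rewrite ?E // in qr *.
have -> : q * size l + r.+1 = q.+1 * size l + 0.
  by rewrite addn0 mulSnr; congr (_ + _); apply/eqP; rewrite eqn_leq rn rn'.
by rewrite mem_beads ?sp.1 //; exact: leq_trans rn.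
Qed.

(** * The two families of cores as images of runner lists *)

(** Treats both signs at once: [adm] holds what closure under t demands beyond c_r <= d. *)
Lemma dcores_image n d t (adm : pred (seq nat)) : 0 < n ->
  (forall l, size l = n -> spaced l ->
    sub_closed t (beads l) <-> (forall r, nth 0 l r <= d) /\ adm l) ->
  dcores n t = (partition_of @` [set` filter adm (runners d n.+1)])%classic.
Proof.
move=> n0 H; apply/seteqP; split=> la.
  move=> /mem_set; rewrite dcoresE => /asboolP[sl b0 nc cn ct].
  have [c Hc] := sub_closed_runners n0 cn.
  pose l := mkseq c n; have szl : size l = n by rewrite size_mkseq.
  have El : beads l = beta la.
    apply: (irr_sorted_eq (leT := gtn)) (sorted_beads l) (sorted_beta sl) _.
    - by move=> y x z /= xy yz; apply: ltn_trans yz xy.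
    - by move=> x; rewrite /= ltnn.
    - move=> x; have rn : x %% n < n by rewrite ltn_mod.
      have := @mem_beads l (x %/ n) (x %% n).
      by rewrite szl -divn_eq => -> //; rewrite nth_mkseq // -Hc -divn_eq.
  have sp : spaced l.
    split; rewrite ?nth_mkseq //.
      by move: b0; rewrite -[0]/(0 * n + 0) Hc -eqn0Ngt => /eqP.
    move=> r; case: (ltnP r.+1 n) => rn; last by right; rewrite nth_default ?szl.
    rewrite !nth_mkseq ?(ltnW rn) //.
    (* If both runners were nonempty, r and r + 1 would be consecutive beads. *)
    case: (posnP (c r)) => [|cr]; [by left | right].
    have := nc r; rewrite -[r]/(0 * n + r) Hc => /(_ cr).
    by rewrite -addnS Hc -eqn0Ngt => /eqP.
  have [le al] : (forall r, nth 0 l r <= d) /\ adm l by apply/H; rewrite ?El.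
  exists l; last by rewrite /partition_of El unbetaK.
  by rewrite /= mem_filter al; apply/runnersP.
move=> [l /=]; rewrite mem_filter => /andP[al /runnersP[sz sp le]] <-.
apply/set_mem; rewrite dcoresE; apply/asboolP.
rewrite /partition_of betaK ?sorted_beads //; split.
- exact/sorted_unbeta/sorted_beads.
- apply/negP => /mem_beadsP[q [r [rn qr E]]].
  have r0 : r = 0 by move/esym/eqP: E; rewrite addn_eq0 => /andP[_ /eqP].
  by move: qr; rewrite r0 sp.1.
- move=> x; exact: spaced_beads.
- move=> x /mem_beadsP[q [r [rn qr ->]]] nx.
  case: q qr nx => [|q] qr nx; first by rewrite -sz leqNgt rn in nx.
  by rewrite mulSn sz -addnA addKn -sz mem_beads // ltnW.
- by apply/H.
Qed.

(** A bead d n + r with r > 0 would force the bead r - 1, next to the bead r. Conversely c_r <= d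
    puts all beads below d n, so closure is vacuous. *)
Lemma dcores_plus_image n d : 0 < n ->
  dcores n (d * n + 1) =
  (partition_of @` [set` filter xpredT (runners d n.+1)])%classic.
Proof.
move=> n0; apply: dcores_image => // l sz sp; split=> [cl|[le _]].
  split=> // r; rewrite leqNgt; apply/negP => dr.
  have rn : r < size l by rewrite ltnNge; apply/negP => le; rewrite nth_default in dr.
  case: r dr rn => [|r] dr rn; first by rewrite sp.1 in dr.
  have := cl (d * size l + r.+1); rewrite mem_beads // sz => /(_ dr).
  rewrite leq_add2l => /(_ isT).
  have -> : d * n + r.+1 - (d * n + 1) = 0 * size l + r.
    by rewrite subnDl subn1 mul0n.
  rewrite mem_beads ?(ltnW rn) //.
  by case: (sp.2 r) => E; rewrite E // in dr *.
move=> x /mem_beadsP[q [r [rn qr ->]]]; have := le r; nia.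
Qed.

(** A bead d n + r would force the bead r + 1, next to r, and the bead d n - 1 at the top of runner
    n - 1 would force the bead 0. Without these no bead reaches d n - 1. *)
Lemma dcores_minus_image n d : 0 < n -> 0 < d ->
  dcores n (d * n - 1) =
  (partition_of @` [set` filter (fun l => nth 0 l n.-1 < d) (runners d n.+1)])%classic.
Proof.
move=> n0 d0; apply: dcores_image => // l sz sp; split=> [cl|[le lt]].
  have nc x : x \in beads l -> x.+1 \notin beads l by exact: spaced_beads.
  split=> [r|].
    rewrite leqNgt; apply/negP => dr.
    have rn : r < size l by rewrite ltnNge; apply/negP => le; rewrite nth_default in dr.
    have := cl (d * size l + r); rewrite mem_beads // sz => /(_ dr).
    have -> : d * n + r - (d * n - 1) = (0 * size l + r).+1 by nia.
    have /negPf -> : (0 * size l + r).+1 \notin beads l.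
      by apply: nc; rewrite mem_beads //; apply: leq_ltn_trans dr.
    by move=> /(_ _) E; apply: notF; apply: E; lia.
  rewrite ltnNge; apply/negP => le.
  have := cl (d.-1 * size l + n.-1); rewrite mem_beads ?sz; last by lia.
  have -> : d.-1 * n + n.-1 = d * n - 1 by nia.
  rewrite subnn -[X in X \in _]/(0 * size l + 0) mem_beads ?sz // sp.1.
  by move=> E; apply: notF; apply: E; lia.
move=> x /mem_beadsP[q [r [rn qr ->]]] tx; have := le r => ler.
have E : r = n.-1 /\ q = d.-1 by nia.
move: qr lt; rewrite E.1 E.2; lia.
Qed.

End BeadSets.

(** * Power sums over the cores *)

Lemma sum_dcores n d t k (adm : pred (seq nat)) : (0 < n)%N ->
  dcores n t = (partition_of @` [set` filter adm (runners d n.+1)])%classic ->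
  \sum_(la \in dcores n t) ((sumn la ^ k)%N%:R : rat) =
  \sum_(l <- runners d n.+1 | adm l) runner_size n%:R l ^+ k.
Proof.
move=> n0 ->; rewrite fsbig_image; last first.
  move=> l l'; rewrite !inE /= !mem_filter => /andP[_ lr] /andP[_ lr'].
  exact: partition_of_inj n0 _ _ lr lr'.
rewrite -fsbig_seq ?filter_uniq ?uniq_runners // big_filter.
rewrite big_seq_cond [RHS]big_seq_cond; apply: eq_bigr => l /andP[lr _].
by have /runnersP[sz _ _] := lr; rewrite natrX sumn_partition_of sz.
Qed.

(** The last entry, at position m, is 0 or some j in 1..d, so the condition drops exactly the case j
    = d. *)
Lemma sum_runners_last_lt d m (f : seq nat -> rat) : (0 < d)%N ->
  \sum_(l <- runners d m.+2 | (nth 0 l m < d)%N) f l =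
  \sum_(l <- runners d m.+2) f l
  - \sum_(l <- runners d m) f (rcons (rcons l 0%N) d).
Proof.
move=> d0; rewrite big_mkcond !big_runnersSS -addrA; congr (_ + _).
  rewrite !big_seq; apply: eq_bigr => l /size_runners [E].
  by rewrite nth_rcons0 nth_default ?d0 // E.
rewrite -sumrB !big_seq; apply: eq_bigr => l /size_runners E.
case: d d0 => // d _; rewrite -[X in iota 1 X]addn1 iotaD add1n !big_cat !big_seq1 /=.
rewrite nth_rcons0j -E eqxx ltnn addr0 addrK.
rewrite !big_seq; apply: eq_bigr => j; rewrite mem_iota add1n => /andP[_ jd].
by rewrite nth_rcons0j -E eqxx jd.
Qed.

Lemma quasi_exists D (s g : nat -> nat -> rat) : quasi D g ->
  (forall m d, (0 < d)%N -> s m.+1 d = g m d) ->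
  exists A B : {poly ratfun}, [/\ (size A <= D)%N, (size B <= D)%N &
    forall n d : nat, (0 < n)%N -> (0 < d)%N ->
    [/\ regular_at A d%:R, regular_at B d%:R & s n d =
      eval_at A n%:R d%:R * (M d n)%:R + eval_at B n%:R d%:R * (M d n.+1)%:R]].
Proof.
move=> /quasi_polyfun[a [b [/polyfun_eval[A sA HA] /polyfun_eval[B sB HB] H]]] Hs.
exists A, B; split=> // -[//|m] d _ d0.
have [rA ->] := HA m.+1 d d0; have [rB ->] := HB m.+1 d d0.
by split=> //; rewrite Hs // H.
Qed.

Theorem theorem1p5 (k : nat) (k_gt0 : (0 < k)%N) :
  (exists A B : {poly ratfun},
    [/\ (size A <= (2 * k).+1)%N,
        (size B <= (2 * k).+1)%N &
        forall n d : nat, (0 < n)%N -> (0 < d)%N ->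
        [/\ regular_at A d%:R,
            regular_at B d%:R &
            \sum_(la \in dcores n (d * n + 1)%N) ((sumn la ^ k)%N%:R : rat)
            = eval_at A n%:R d%:R * (M d n)%:R
              + eval_at B n%:R d%:R * (M d n.+1)%:R]])
  /\
  (exists A' B' : {poly ratfun},
    [/\ (size A' <= (2 * k).+1)%N,
        (size B' <= (2 * k).+1)%N &
        forall n d : nat, (0 < n)%N -> (0 < d)%N ->
        [/\ regular_at A' d%:R,
            regular_at B' d%:R &
            \sum_(la \in dcores n (d * n - 1)%N) ((sumn la ^ k)%N%:R : rat)
            = eval_at A' n%:R d%:R * (M d n)%:R
              + eval_at B' n%:R d%:R * (M d n.+1)%:R]]).
Proof.
split.
  apply: quasi_exists (quasi_runner_size k) _ => m d d0.
  by rewrite (sum_dcores k _ (dcores_plus_image d _)).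
apply: quasi_exists (quasi_sub (quasi_runner_size k) (quasi_runner_size_last k)) _.
move=> m d d0; rewrite (sum_dcores k _ (dcores_minus_image _ d0)) //.
exact: sum_runners_last_lt.
Qed.
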